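(* Let $\delta,L>0$, $\mathcal{S}=[0,\delta]$, $\alpha>0$, $K\in\mathbb{N}\cup\{+\infty\}$, $c_\delta=2\pi/\delta$, and let $u$ be the random function $$u(x)=\sum_{k=1}^K X_k\,k^{-\alpha}\bigl(\cos(c_\delta kx)+\sin(c_\delta kx)\bigr),$$ with $\{X_k\}$ independent standard normal random variables. Assume that (i) the interaction term has the shift-factorized form $g[u](x,s)=(\mathcal{B}u)(x-s)$, where $\mathcal{B}$ is a translation-invariant operator with Hermitian-symmetric Fourier symbol $\widehat{\mathcal{B}}$, i.e. $\widehat{\mathcal{B}}(-\xi)=\overline{\widehat{\mathcal{B}}(\xi)}$; (ii) the observation domain $\Omega=[0,L]$ satisfies $2L/\delta\in\mathbb{N}$. Let $\mathcal{L}:L^2(\mathcal{S})\to L^2(\mathcal{S})$ be defined by $\langle\mathcal{L}\phi,\psi\rangle_{L^2(\mathcal{S})}=\mathbb{E}_u\bigl[\langle R_\phi[u],R_\psi[u]\rangle_{L^2(\Omega)}\bigr]$, where $R_\phi[u](x)=\int_{\mathcal{S}}\phi(s)\,g[u](x,s)\,ds$ for $x\in\Omega$. Then the non-zero eigenvalues of $\mathcal{L}$ are $$\lambda_j(\mathcal{L})=\frac{L\delta}{2}\,|\widehat{\mathcal{B}}(\theta_j)|^2\,j^{-2\alpha},\qquad j=1,\dots,K,$$ where $\theta_j:=c_\delta j=2\pi j/\delta$ is the $j$-th Fourier frequency of the random function $u$ (with $j$ ranging over all positive integers if $K=\infty$). If, in addition, $K=\infty$ and $\widehat{\mathcal{B}}$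 has polynomial decay of order $\rho$, i.e. $c_1|k|^{-\rho}\le|\widehat{\mathcal{B}}(k)|\le c_2|k|^{-\rho}$ as $|k|\to\infty$ for constants $0<c_1\le c_2$, then the eigenvalues of $\mathcal{L}$ decay polynomially at rate $\gamma=2(\alpha+\rho)$: $\underline{c}_{\mathcal{L}}\,j^{-\gamma}\le\lambda_j(\mathcal{L})\le\overline{c}_{\mathcal{L}}\,j^{-\gamma}$ for constants $0<\underline{c}_{\mathcal{L}}\le\overline{c}_{\mathcal{L}}$.
   Context: A bounded linear operator $\mathcal{B}$ on $L^2(\mathbb{R})$ is translation-invariant if it commutes with all translations $(T_sv)(x)=v(x-s)$. Such an operator acts as multiplication in the Fourier domain, $\widehat{\mathcal{B}v}(\xi)=\widehat{\mathcal{B}}(\xi)\widehat{v}(\xi)$; the function $\widehat{\mathcal{B}}:\mathbb{R}\to\mathbb{C}$ is called its Fourier symbol. The operator is applied to the trigonometric functions in $u$ through the symbol, $\mathcal{B}(e^{i\xi x})=\widehat{\mathcal{B}}(\xi)e^{i\xi x}$, and to $u$ term by term: $\mathcal{B}u=\sum_{j=1}^K X_j\,j^{-\alpha}\,\mathcal{B}v_j$ with $v_j(x)=\cos(\theta_jx)+\sin(\theta_jx)$. The spaces $L^2(\mathcal{S})$ and $L^2(\Omega)$ carry their usual inner products, and $\mathbb{E}_u$ denotes expectation over the random function $u$. The numbers $\lambda_j(\mathcal{L})$ are indexed by the frequency $j$ and are not counted with multiplicity.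
   Formalization: The decay bounds on the eigenvalues are stated for all large j, since the symbol may vanish at the first frequencies; for K = ∞, where the series for u need not converge to a function when α ≤ 1/2, R_φ[u] is the mean-square limit of the responses to the partial sums. *)

(* Defs.v *)
From HB Require Import structures.
From mathcomp Require Import all_boot all_order all_algebra.
From mathcomp Require Import all_classical all_reals all_analysis.
From mathcomp Require Import complex ring.
Import Order.TTheory GRing.Theory Num.Theory.
Import numFieldNormedType.Exports.

Set Implicit Arguments.
Unset Strict Implicit.
Unset Printing Implicit Defensive.

Local Open Scope classical_set_scope.
Local Open Scope ring_scope.

Section fourier_multipliers.
Context {R : realType}.
Local Notation mu := (@lebesgue_measure R).
Local Notation normc := ComplexField.Normc.normc.
Implicit Types (v w : R -> R[i]).

Definition expi (t : R) : R[i] := Complex (cos t) (sin t).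

Definition L2C v : Prop :=
  ((fun x => complex.Re (v x)) \in Lfun mu 2%:E) /\
  ((fun x => complex.Im (v x)) \in Lfun mu 2%:E).

Definition sqnorm_L2C v : \bar R := (\int[mu]_x (normc (v x) ^+ 2)%:E)%E.

Definition ae_eqC v w : Prop := {ae mu, forall x, v x = w x}.

Definition Cintegral (D : set R) v : R[i] :=
  Complex (\int[mu]_(x in D) complex.Re (v x))
          (\int[mu]_(x in D) complex.Im (v x)).

Definition fourier_trunc v (n : nat) (xi : R) : R[i] :=
  Cintegral `[- n%:R, n%:R] (fun x => v x * expi (- (xi * x))).

(* [vh] is the Fourier--Plancherel transform of [v], i.e. the limit in L^2(R)
   of the truncated Fourier integrals. The normalisation is immaterial for
   multipliers. *)
Definition is_fourier v vh : Prop :=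
  [/\ L2C v, L2C vh &
      sqnorm_L2C (fun xi => vh xi - fourier_trunc v n xi) @[n --> \oo]
        --> 0%E].

(* L^2(R) consists here of functions and its equality is [ae_eqC]; an operator
   that satisfies [bounded_linear_op] is compatible with that equality. *)
Definition bounded_linear_op (B : (R -> R[i]) -> R -> R[i]) : Prop :=
  [/\ forall v, L2C v -> L2C (B v),
      forall (a : R[i]) v w, L2C v -> L2C w ->
        ae_eqC (B (fun x => a * v x + w x)) (fun x => a * B v x + B w x) &
      exists C : R, forall v, L2C v ->
        (sqnorm_L2C (B v) <= C%:E * sqnorm_L2C v)%E].

Definition translate (s : R) v : R -> R[i] := fun x => v (x - s).

Definition translation_invariant (B : (R -> R[i]) -> R -> R[i]) : Prop :=
  forall s v, L2C v -> ae_eqC (B (translate s v)) (translate s (B v)).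

Definition fourier_symbol (B : (R -> R[i]) -> R -> R[i]) (bhat : R -> R[i]) :
    Prop :=
  forall v vh, is_fourier v vh -> is_fourier (B v) (fun xi => bhat xi * vh xi).

Definition hermitian_symmetric (bhat : R -> R[i]) : Prop :=
  forall xi, bhat (- xi) = conjc (bhat xi).

Definition polynomial_decay (bhat : R -> R[i]) (rho : R) : Prop :=
  exists c1 c2 M : R, [/\ 0 < c1, c1 <= c2 & forall k : R, M <= `|k| ->
    c1 * `|k| `^ (- rho) <= normc (bhat k) <= c2 * `|k| `^ (- rho)].

Definition symbol_exp (bhat : R -> R[i]) (xi x : R) : R[i] :=
  bhat xi * expi (xi * x).

(* The image of cos (theta x) + sin (theta x), by linearity from
   cos t = (e^{it} + e^{-it}) / 2 and sin t = (e^{it} - e^{-it}) / 2i. *)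
Definition symbol_cossin (bhat : R -> R[i]) (theta x : R) : R[i] :=
  (symbol_exp bhat theta x + symbol_exp bhat (- theta) x) / 2
  + (symbol_exp bhat theta x - symbol_exp bhat (- theta) x)
    / (2 * Complex 0 1).

Let invr2C : (2 : R[i])^-1 = Complex 2^-1 0.
Proof. by rewrite -[2 in LHS](rmorph_nat (real_complex R)) -fmorphV. Qed.

Let invr2i : (2 * Complex 0 1 : R[i])^-1 = Complex 0 (- 2^-1).
Proof.
rewrite invfM invr2C; have i0 : (Complex 0 1 : R[i]) != 0.
  by rewrite eq_complex /= oner_eq0 andbF.
apply: (mulIf i0); rewrite mulfVK//; apply/eqP; rewrite eq_complex /=.
by apply/andP; split; apply/eqP; ring.
Qed.

Lemma symbol_cossin_real bhat theta x : hermitian_symmetric bhat ->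
  complex.Im (symbol_cossin bhat theta x) = 0.
Proof.
move=> bhatN; rewrite /symbol_cossin /symbol_exp bhatN /expi mulNr cosN sinN.
by rewrite invr2C invr2i; case: (bhat theta) => a b /=; ring.
Qed.

Lemma symbol_cossin1 theta x :
  symbol_cossin (fun=> 1) theta x =
  Complex (cos (theta * x) + sin (theta * x)) 0.
Proof.
rewrite /symbol_cossin /symbol_exp /expi mulNr cosN sinN invr2C invr2i.
by rewrite !mul1r; apply/eqP; rewrite eq_complex /=; apply/andP; split;
  apply/eqP; field.
Qed.

End fourier_multipliers.

Section interval_L2.
Context {R : realType}.
Local Notation mu := (@lebesgue_measure R).
Implicit Types (a b : R) (f g : R -> R).

Definition L2_itv a b f : Prop :=
  f \in Lfun (mrestr mu (measurable_itv `[a, b])) 2%:E.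

Definition inner_itv a b f g : R := \int[mu]_(x in `[a, b]) (f x * g x).

(* Elements of L^2([a, b]) are given by representatives, so a non-zero vector
   is one that does not vanish almost everywhere on [a, b]. *)
Definition eigenvalue_L2 a b (Lop : (R -> R) -> R -> R) (m : R) : Prop :=
  exists phi, [/\ L2_itv a b phi, ~ ae_eq mu `[a, b]%classic phi (cst 0) &
    ae_eq mu `[a, b]%classic (Lop phi) (fun s => m * phi s)].

End interval_L2.

(* The number K of random modes, with [None] for K = +oo. *)
Definition mode (K : option nat) (j : nat) : bool :=
  (0 < j)%N && (if K is Some k then (j <= k)%N else true).

Section random_function.
Context {d : measure_display} {T : measurableType d} {R : realType}.
Local Notation mu := (@lebesgue_measure R).
Local Notation normc := ComplexField.Normc.normc.
Variables (P : probability T R) (X : nat -> {RV P >-> R}).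

Definition mutually_independent (I : pred nat) : Prop :=
  forall (s : seq nat) (A : nat -> set R),
    uniq s -> all I s -> (forall k, measurable (A k)) ->
    P (\big[setI/setT]_(k <- s) (X k @^-1` A k)) =
    (\prod_(k <- s) P (X k @^-1` A k))%E.

Definition standard_normal (k : nat) : Prop :=
  forall A : set R, measurable A -> distribution P (X k) A = normal_prob 0 1 A.

Variables (delta L alpha : R) (bhat : R -> R[i]).

Definition freq (j : nat) : R := 2 * pi * j%:R / delta.

Definition u_partial (n : nat) (w : T) (x : R) : R :=
  \sum_(1 <= k < n.+1)
    X k w * k%:R `^ (- alpha) * (cos (freq k * x) + sin (freq k * x)).

(* B applied term by term to [u_partial n]. Under the Hermitian symmetry of
   [bhat] the real part discards nothing, see [symbol_cossin_real]. *)
Definition Bu_partial (n : nat) (w : T) (x : R) : R :=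
  \sum_(1 <= k < n.+1)
    X k w * k%:R `^ (- alpha) * complex.Re (symbol_cossin bhat (freq k) x).

Definition g_partial (n : nat) (w : T) (x s : R) : R :=
  Bu_partial n w (x - s).

Definition response_partial (phi : R -> R) (n : nat) (w : T) (x : R) : R :=
  \int[mu]_(s in `[0, delta]) (phi s * g_partial n w x s).

(* [Rphi] is the random function R_phi[u] on Omega = [0, L]. For infinitely
   many modes, B u is the sum of its series in the sense that the responses to
   the partial sums converge in L^2(P x Omega). For small alpha the series of
   u is not a function but only a random distribution, whose pairing with phi
   still makes sense; if the series of B u converges in mean square on
   [- delta, L], then R_phi is the integral of phi s * (B u) (x - s). *)
Definition is_response (K : option nat) (phi : R -> R) (Rphi : T -> R -> R) :
    Prop :=
  if K is Some k then
    forall w x, x \in `[0, L] -> Rphi w x = response_partial phi k w x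
  else
    measurable_fun (setT `*` `[0, L]) (fun p : T * R => Rphi p.1 p.2) /\
    (\int[P]_w \int[mu]_(x in `[0%R, L])
        ((Rphi w x - response_partial phi n w x) ^+ 2)%:E)%E
      @[n --> \oo] --> 0%E.

Definition is_interaction_operator (Rf : (R -> R) -> T -> R -> R)
    (Lop : (R -> R) -> R -> R) : Prop :=
  forall phi, L2_itv 0 delta phi ->
    L2_itv 0 delta (Lop phi) /\
    forall psi, L2_itv 0 delta psi ->
      (inner_itv 0 delta (Lop phi) psi)%:E =
      'E_P[fun w => inner_itv 0 L (Rf phi w) (Rf psi w)]%E.

Definition lambda (j : nat) : R :=
  L * delta / 2 * normc (bhat (freq j)) ^+ 2 * j%:R `^ (- (2 * alpha)).

End random_function.

Lemma Bu_partial1 d (T : measurableType d) (R : realType)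
    (P : probability T R) (X : nat -> {RV P >-> R}) (delta alpha : R) :
  Bu_partial X delta alpha (fun=> 1) = u_partial X delta alpha.
Proof.
apply/funext => n; apply/funext => w; apply/funext => x.
by apply: eq_bigr => k _; rewrite symbol_cossin1.
Qed.

(* Main.v *)
(* Expanding cos (theta_k (x - s)) and sin (theta_k (x - s)), the response is
   R_phi[u] = sum_k X_k h_k with h_k a combination of cos (theta_k x) and
   sin (theta_k x) whose coefficients are linear in the Fourier coefficients
   C_k(phi), S_k(phi) of phi on [0, delta]. Since E[X_k X_l] is 1 if k = l and
   0 otherwise, and since 2 L / delta is an integer, so that cos (theta_k x) and
   sin (theta_k x) are orthogonal of square norm L / 2 on [0, L],
     <Lop phi, psi> = sum_k L |bhat(theta_k)|^2 k^(-2 alpha)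
                        (C_k(phi) C_k(psi) + S_k(phi) S_k(psi)),
   where for K = +oo the partial sums converge by continuity of the inner
   product of L^2(P x Omega). Testing this on cos (theta_j s) and sin (theta_j s) shows
   that these are eigenvectors for lambda_j, and that an eigenvector for a value
   m different from 0 and from every lambda_j has vanishing coefficients, hence
   is zero; completeness of the trigonometric system is not needed. *)
Require Import Defs.
From mathcomp Require Import all_boot all_order all_algebra.
From mathcomp Require Import all_classical all_reals all_analysis.
From mathcomp Require Import complex.
From mathcomp Require Import measurable_realfun ring lra.
Import Order.TTheory GRing.Theory Num.Theory.
Import numFieldNormedType.Exports.

Local Open Scope classical_set_scope.
Local Open Scope ring_scope.

Lemma measurable_EFin_sqr {R : realType} :
  measurable_fun [set: R] (fun x : R => (x ^+ 2)%:E).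
Proof.
apply/measurable_EFinP; apply: continuous_measurable_fun.
exact: exprn_continuous.
Qed.

(** * Moments of the standard normal law *)

Section normal_moments.
Context {R : realType}.
Local Notation mu := (@lebesgue_measure R).
Local Notation pdf := (@normal_pdf R 0 1).

(** The Radon-Nikodym derivative of the law and [pdf] have the same integral over every measurable
    set, hence agree almost everywhere, and one may replace the other in the change of variables. *)
Lemma ge0_integral_normal_prob (f : R -> \bar R) :
  measurable_fun [set: R] f -> (forall x, 0 <= f x)%E ->
  (\int[normal_prob 0 1]_x f x = \int[mu]_x (f x * (pdf x)%:E))%E.
Proof.
move=> mf f0.
have dom := @normal_prob_dominates R 0 1.
rewrite -(Radon_Nikodym_SigmaFinite.change_of_variables dom)//.
apply: ae_eq_integral => //.
- apply: emeasurable_funM => //.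
  exact: measurable_int (Radon_Nikodym_SigmaFinite.f_integrable dom).
- apply: emeasurable_funM => //; apply/measurable_EFinP.
  exact: measurable_normal_pdf.
- apply: ae_eqe_mul2l; apply: integral_ae_eq => //.
  + exact: Radon_Nikodym_SigmaFinite.f_integrable.
  + by apply/measurable_EFinP; exact: measurable_normal_pdf.
  + by move=> E _ mE; rewrite -Radon_Nikodym_SigmaFinite.f_integral.
Qed.

Lemma normal_pdfN (x : R) : pdf (- x) = pdf x.
Proof. by rewrite normal_pdfE ?oner_neq0// /normal_fun !subr0 sqrrN. Qed.

Lemma is_derive_normal_pdf (x : R) : is_derive x (1 : R) pdf (- x * pdf x).
Proof.
rewrite normal_pdfE ?oner_neq0// /normal_fun.
apply: is_derive_eq.
rewrite !subr0 /GRing.scale /=; set e := expR _; by field.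
Qed.

Let pdf_ge0 (x : R) : 0 <= pdf x. Proof. exact: normal_pdf_ge0. Qed.

Let cpdf : continuous pdf.
Proof. by apply: continuous_normal_pdf; rewrite oner_neq0. Qed.

Let cXpdf n : continuous (fun x : R => x ^+ n * pdf x).
Proof. by move=> x; apply: cvgM; [exact: exprn_continuous|exact: cpdf]. Qed.

(** Squeeze: exp(y) >= 1 + y at y = x^2 / 2 gives x exp(- x^2 / 2) <= 2 / x. This is the boundary
    term at infinity in [int1y]. *)
Let cvgMpdf : x * pdf x @[x --> +oo] --> (0 : R).
Proof.
rewrite normal_pdfE ?oner_neq0// /normal_fun.
set c := normal_peak 1.
have c0 : 0 <= c by exact: normal_peak_ge0.
have h : c * 2 * x^-1 @[x --> +oo] --> (0 : R).
  rewrite -[X in _ --> X](mulr0 (c * 2)); apply: cvgMr.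
  by apply/(gtr0_cvgV0 (f := id)) => //; exact: nbhs_pinfty_gt.
apply: (squeeze_cvgr _ (cvg_cst (0 : R)) h).
near=> x; have x0 : 0 < x by near: x; exact: nbhs_pinfty_gt.
apply/andP; split; first by rewrite mulr_ge0 ?(ltW x0)// mulr_ge0 ?expR_ge0.
rewrite subr0 mulrCA -mulrA ler_wpM2l// mulNr expRN ler_pdivlMr//.
rewrite mulrAC ler_pdivrMr ?expR_gt0//.
apply: le_trans (ler_wpM2l (ltW (ltr0n R 2)) (expR_ge1Dx _)).
by rewrite expr1n mulrDr mulr1 (mulrC 2 (_ / _)) divfK ?pnatr_eq0// expr2 lerDr.
Unshelve. all: by end_near. Qed.

Let is_derive_Mpdf (x : R) :
  is_derive x (1 : R) (fun y => y * pdf y) ((1 - x ^+ 2) * pdf x).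
Proof.
apply: is_derive_eq.
  apply: is_deriveM; exact: is_derive_normal_pdf.
by rewrite /GRing.scale /=; ring.
Qed.

Let integrable_pdf D : measurable D -> mu.-integrable D (fun x => (pdf x)%:E).
Proof.
by move=> mD; apply: integrableS (integrable_normal_pdf 0 1).
Qed.

(** The second moment is compared with the total mass through (x p)' = (1 - x^2) p. The half-line is
    cut at 1, where this derivative changes sign, because the improper fundamental theorem used in
    [int1y] asks for a non-negative integrand. The boundary terms [pdf 1] of the two pieces cancel
    in [normal_moment2]. *)
Let int01 : (\int[mu]_(x in `[0%R, 1%R]) (pdf x)%:E =
  \int[mu]_(x in `[0%R, 1%R]) (x ^+ 2 * pdf x)%:E + (pdf 1)%:E)%E.
Proof.
have cf : continuous (fun x : R => (1 - x ^+ 2) * pdf x).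
  move=> x; apply: cvgM; last exact: cpdf.
  by apply: cvgB; [exact: cvg_cst|exact: exprn_continuous].
have := @continuous_FTC2 R _ (fun x => x * pdf x) 0 1 ltr01
  (continuous_subspaceT cf).
rewrite mul0r mul1r sube0 => <-; last 2 first.
- have Fx (x : R) : {for x, continuous (fun x : R => x * pdf x)}.
    by apply: cvgM => //; exact: cpdf.
  split.
  + by move=> x _; have [] := is_derive_Mpdf x.
  + exact/cvg_at_right_filter/Fx.
  + exact/cvg_at_left_filter/Fx.
- move=> x _; rewrite derive1E.
  exact: (@derive_val _ _ _ _ _ _ _ (is_derive_Mpdf x)).
rewrite -integralD//=; last 2 first.
- apply: continuous_compact_integrable; first exact: segment_compact.
  by apply: continuous_subspaceT; exact: cXpdf.
- apply: continuous_compact_integrable; first exact: segment_compact.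
  exact: continuous_subspaceT.
by apply: eq_integral => x _; rewrite -EFinD -mulrDl addrC subrK mul1r.
Qed.

Let int1y : (\int[mu]_(x in `[1%R, +oo[) (x ^+ 2 * pdf x)%:E =
  \int[mu]_(x in `[1%R, +oo[) (pdf x)%:E + (pdf 1)%:E)%E.
Proof.
have cf : continuous (fun x : R => (x ^+ 2 - 1) * pdf x).
  move=> x; apply: cvgM; last exact: cpdf.
  by apply: cvgB; [exact: exprn_continuous|exact: cvg_cst].
have f0 (x : R) : 1 <= x -> 0 <= (x ^+ 2 - 1) * pdf x.
  by move=> x1; rewrite mulr_ge0// subr_ge0 expr_ge1// (le_trans ler01).
have := @ge0_continuous_FTC2y R _ (fun x => - (x * pdf x)) 1 0 f0
  (continuous_subspaceT cf).
rewrite mul1r EFinN oppeK add0e => <-; last 4 first.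
- rewrite -[X in _ --> X]oppr0; exact: (cvgN cvgMpdf).
- by move=> x _; have ? := is_derive_Mpdf x; apply: derivableN.
- apply: cvg_at_right_filter; apply: cvgN; rewrite -[X in _ --> X]mul1r.
  by apply: cvgM; [exact: cvg_id|exact: cpdf].
- move=> x _; have ? := is_derive_Mpdf x; rewrite derive1E deriveN//.
  by rewrite derive_val -mulNr opprB.
rewrite -ge0_integralD//=; first last.
- by apply/measurable_EFinP/measurable_funTS; exact: continuous_measurable_fun.
- by move=> x; rewrite in_itv/= andbT lee_fin; exact: f0.
- by apply: (measurable_int mu); exact: integrable_pdf.
- by move=> x _; rewrite lee_fin.
by apply: eq_integral => x _; rewrite -EFinD mulrBl mul1r addrC subrK.
Qed.

Let split01 (f : R -> R) : (forall x, 0 <= f x) -> continuous f ->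
  (\int[mu]_(x in `[0%R, +oo[) (f x)%:E =
   \int[mu]_(x in `[0%R, 1%R]) (f x)%:E +
   \int[mu]_(x in `[1%R, +oo[) (f x)%:E)%E.
Proof.
move=> f0 cf.
have mf D : measurable_fun D (fun x => (f x)%:E).
  by apply/measurable_EFinP/measurable_funTS; exact: continuous_measurable_fun.
rewrite -(@integral_itv_obnd_cbnd _ 1)//.
rewrite -ge0_integral_setU//=.
- by rewrite -itv_bndbnd_setU// bnd_simp.
- exact: mf.
- by move=> x _; rewrite lee_fin.
- apply/disj_setPS => x [] /=; rewrite !in_itv/= andbT => /andP[_ x1].
  by rewrite ltNge x1.
Qed.

(** By evenness it is enough to compare x^2 p with p on the half-line, where [int01] and [int1y]
    show that the integrals coincide. *)
Lemma normal_moment2 : (\int[@normal_prob R 0 1]_x (x ^+ 2)%:E = 1)%E.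
Proof.
rewrite ge0_integral_normal_prob; last 2 first.
- exact: measurable_EFin_sqr.
- by move=> x; rewrite lee_fin sqr_ge0.
under eq_integral do rewrite -EFinM.
have f0 (x : R) : 0 <= x ^+ 2 * pdf x by rewrite mulr_ge0// sqr_ge0.
rewrite ge0_symfun_integralT//; last by move=> x /=; rewrite normal_pdfN sqrrN.
rewrite -set_itvcy split01//.
rewrite int1y addeA addeAC -int01.
rewrite -split01// set_itvcy -ge0_symfun_integralT//.
  exact: integral_normal_pdf.
by move=> x /=; rewrite normal_pdfN.
Qed.

Lemma ge0_integral_opp (f : R -> \bar R) :
  measurable_fun [set: R] f -> (forall x, 0 <= f x)%E ->
  (\int[mu]_x f (- x)%R = \int[mu]_x f x)%E.
Proof.
move=> mf f0.
transitivity (\int[pushforward mu (-%R : _ -> measurableTypeR R)]_x f x)%E.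
  by rewrite ge0_integral_pushforward.
by apply: eq_measure_integral => //= A mA AS; exact: lebesgue_measureN.
Qed.

Lemma integrable_normal_sqr :
  (@normal_prob R 0 1).-integrable [set: R] (fun x => (x ^+ 2)%:E).
Proof.
apply/integrableP; split; first exact: measurable_EFin_sqr.
under eq_integral do rewrite gee0_abs ?lee_fin ?sqr_ge0//.
by rewrite normal_moment2 ltry.
Qed.

(** Domination: |x| <= 1 + x^2, which is integrable for a probability with finite second moment. *)
Lemma integrable_normal_id :
  (@normal_prob R 0 1).-integrable [set: R] (fun x => x%:E).
Proof.
have i2 : (@normal_prob R 0 1).-integrable [set: R] (fun x => (1 + x ^+ 2)%:E).
  have i1 := finite_measure_integrable_cst (@normal_prob R 0 1) 1 measurableT.
  exact: (integrableD measurableT i1 integrable_normal_sqr).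
apply: le_integrable i2 => //= [|x _].
  by apply/measurable_EFinP; exact: measurable_id.
rewrite lee_fin (ger0_norm (_ : 0 <= 1 + x ^+ 2)) ?addr_ge0 ?sqr_ge0//.
rewrite -real_normK ?num_real//.
have := sqr_ge0 (`|x| - 1); have := normr_ge0 x.
by move: `|x| => y; rewrite sqrrB1 => y0 h; nra.
Qed.

(** Reflection exchanges the positive and negative parts of x and preserves the even density, so
    both parts have the same integral; it is finite, so the difference is 0. *)
Lemma normal_moment1 : (\int[@normal_prob R 0 1]_x x%:E = 0)%E.
Proof.
have fin := integrable_pos_fin_num measurableT integrable_normal_id.
rewrite integralE.
have mid : measurable_fun [set: R] (fun x : R => x%:E).
  by apply/measurable_EFinP; exact: measurable_id.
have mp := measurable_funepos mid.
have mn := measurable_funeneg mid.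
suff -> : (\int[@normal_prob R 0 1]_x (fun x : R => x%:E)^\-%E x =
  \int[@normal_prob R 0 1]_x (fun x : R => x%:E)^\+%E x)%E by rewrite subee.
rewrite !ge0_integral_normal_prob//.
rewrite -[RHS]ge0_integral_opp//.
- apply: eq_integral => x _; rewrite normal_pdfN; congr (_ * _)%E.
  by rewrite funenegE funeposE.
- apply: emeasurable_funM => //.
  by apply/measurable_EFinP; exact: measurable_normal_pdf.
- by move=> x; rewrite mule_ge0// lee_fin.
Qed.

End normal_moments.

(** * Square-integrability and finite sums of integrals *)

Section square_integrable.
Context {d} {T : measurableType d} {R : realType}.
Variable m : {measure set T -> \bar R}.

Lemma Lfun2P (f : T -> R) : f \in Lfun m 2%:E <->
  measurable_fun [set: T] f /\ (\int[m]_x (f x ^+ 2)%:E < +oo)%E.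
Proof.
split=> [fL|[mf foo]].
  split; first by move: fL => /andP[/[!inE]].
  have /integrableP[_] := Lfun2_integrable_sqr fL.
  by under eq_integral do rewrite gee0_abs ?lee_fin ?sqr_ge0//.
rewrite inE; apply/andP; split; rewrite inE//=.
rewrite /finite_norm unlock; apply: poweR_lty.
apply: le_lt_trans foo; rewrite le_eqVlt; apply/orP; left; apply/eqP.
apply: eq_integral => x _ /=.
by rewrite powR_mulrn// real_normK ?num_real.
Qed.

Lemma Rintegral_sum D I (s : seq I) (f : I -> T -> R) : measurable D ->
  (forall i, m.-integrable D (EFin \o f i)) ->
  \int[m]_(x in D) (\sum_(i <- s) f i x) = \sum_(i <- s) \int[m]_(x in D) f i x.
Proof.
move=> mD intf; elim: s => [|i s ih].
  under eq_Rintegral do rewrite big_nil.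
  by rewrite Rintegral_cst// mul0r big_nil.
under eq_Rintegral do rewrite big_cons.
rewrite RintegralD// ?big_cons ?ih//.
have := @integrable_sum _ _ _ m D mD _ s predT (fun i x => (f i x)%:E)
  (fun i _ => intf i).
by apply: eq_integrable => // x _ /=; rewrite sumEFin.
Qed.

End square_integrable.

(** * Moments and products of the random coefficients *)

Section independence.
Context {d : measure_display} {T : measurableType d} {R : realType}.
Variables (P : probability T R) (X : nat -> {RV P >-> R}) (I : pred nat).
Hypotheses (X_indep : mutually_independent X I)
  (X_normal : forall k, I k -> standard_normal X k).

Lemma integral_standard_normal k (f : R -> \bar R) : I k ->
  measurable_fun [set: R] f -> (@normal_prob R 0 1).-integrable [set: R] f ->
  (\int[distribution P (X k)]_x f x = \int[@normal_prob R 0 1]_x f x)%E.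
Proof.
move=> Ik mf intf.
(* [R] and [measurableTypeR R] have the same measurable sets but different
   displays, hence the pushforward along the identity. *)
pose i : measurableTypeR R -> R := id.
have mi : measurable_fun [set: measurableTypeR R] i.
  by move=> _ Y mY; rewrite setTI.
transitivity (\int[pushforward (@normal_prob R 0 1) i]_x f x)%E.
  by apply: eq_measure_integral => A mA _; exact: X_normal.
by rewrite integral_pushforward.
Qed.

Lemma moment2_standard_normal k : I k -> (\int[P]_w ((X k w) ^+ 2)%:E = 1)%E.
Proof.
move=> Ik; rewrite -normal_moment2.
have mf := @measurable_EFin_sqr R.
rewrite -(@integral_standard_normal k)//.
  rewrite ge0_integral_distribution//.
  by move=> y; rewrite lee_fin sqr_ge0.
exact: integrable_normal_sqr.
Qed.

Lemma Lfun2_standard_normal k : I k -> (X k : T -> R) \in Lfun P 2%:E.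
Proof.
by move=> Ik; apply/Lfun2P; split => //; rewrite moment2_standard_normal// ltry.
Qed.

Lemma integrable_standard_normal k : I k ->
  P.-integrable [set: T] (fun w => (X k w)%:E).
Proof.
move=> Ik; apply/Lfun1_integrable.
apply: Lfun_subset12; last exact: Lfun2_standard_normal.
exact: fin_num_measure.
Qed.

Lemma moment1_standard_normal k : I k -> (\int[P]_w (X k w)%:E = 0)%E.
Proof.
move=> Ik; rewrite -normal_moment1.
have mf : measurable_fun [set: R] (fun x : R => x%:E).
  by apply/measurable_EFinP; exact: measurable_id.
rewrite -(@integral_standard_normal k)//; last exact: integrable_normal_id.
by rewrite integral_distribution//; exact: integrable_standard_normal.
Qed.

(** Independence says that the joint law of the pair agrees with the product of the marginals on
    rectangles, so the two are equal by uniqueness of the product measure. Fubini and the zero mean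
    then give 0. *)
Lemma integral_mul_independent k l : I k -> I l -> k != l ->
  (\int[P]_w (X k w * X l w)%:E = 0)%E.
Proof.
move=> Ik Il kl.
pose XY := fun w => (X k w, X l w).
have mXY : measurable_fun [set: T] XY by exact: measurable_fun_pair.
have ixy : P.-integrable [set: T] (fun w => (X k w * X l w)%:E).
  apply/Lfun1_integrable; apply: Lfun2_mul_Lfun1; exact: Lfun2_standard_normal.
pose mulp := fun p : R * R => (p.1 * p.2)%:E.
have mmul : measurable_fun [set: R * R] mulp.
  by apply/measurable_EFinP; apply: measurable_funM.
pose M := (distribution P (X k) \x distribution P (X l))%E.
have push : forall A, measurable A -> M A = pushforward P XY A.
  apply: product_measure_unique => A B mA mB.
  (* Independence is stated for a family of sets indexed by all naturals; since k and l differ, [C]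
     takes the value [A] at k and [B] at l. *)
  pose C n := if n == k then A else B.
  have mC n : measurable (C n) by rewrite /C; case: ifP.
  have := X_indep [:: k; l] C; rewrite /= Ik Il inE kl => /(_ isT isT mC).
  rewrite !big_cons !big_nil setIT mule1 /C eqxx eq_sym (negbTE kl) => <-.
  by congr (P _); apply/seteqP; split=> w.
have inM : M.-integrable [set: R * R] mulp.
  have /integrableP[_ foo] := integrable_pushforward mXY mmul ixy measurableT.
  apply/integrableP; split => //; apply: le_lt_trans foo.
  rewrite le_eqVlt; apply/orP; left; apply/eqP.
  by apply: eq_measure_integral => A mA _; exact: push.
transitivity (\int[pushforward P XY]_p mulp p)%E.
  by rewrite integral_pushforward.
transitivity (\int[M]_p mulp p)%E.
  by apply: eq_measure_integral => A mA _; exact/esym/push.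
rewrite -integral12_prod_meas1// /fubini_F /mulp/=.
have mid : measurable_fun [set: R] (fun x : R => x%:E).
  by apply/measurable_EFinP; exact: measurable_id.
under eq_integral => x _.
  under eq_integral do rewrite EFinM.
  rewrite integralZl//; last first.
    by apply: integrable_pushforward => //; exact: integrable_standard_normal.
  rewrite integral_distribution//; last exact: integrable_standard_normal.
  rewrite moment1_standard_normal// mule0.
  over.
by rewrite integral0.
Qed.

End independence.

(** * Cauchy-Schwarz and continuity of the inner product *)

Section L2_inner_product.
Context {d} {T : measurableType d} {R : realType}.
Variable m : {measure set T -> \bar R}.
Implicit Types f g : T -> R.
Local Notation L2 := (Lfun m 2%:E).
Local Notation ip f g := (\int[m]_x (f x * g x))%R.

Lemma Lfun2_integrable_mul f g : f \in L2 -> g \in L2 ->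
  m.-integrable [set: T] (fun x => (f x * g x)%:E).
Proof. by move=> fL gL; apply/Lfun1_integrable; exact: Lfun2_mul_Lfun1. Qed.

Lemma Lfun2Z f (t : R) : f \in L2 -> (fun x => t * f x) \in L2.
Proof.
move=> fL; have -> : (fun x => t * f x) = t \o* f.
  by apply/funext => x /=; rewrite mulrC.
by apply: Lfun_scale => //; rewrite ler1n.
Qed.

Lemma Lfun2_subZ f g (t : R) : f \in L2 -> g \in L2 ->
  (fun x => f x - t * g x) \in L2.
Proof.
move=> fL gL; have tg := Lfun2Z g t gL.
have -> : (fun x => f x - t * g x) = f \- (fun x => t * g x) by [].
by rewrite rpredB ?lee1n.
Qed.

Lemma Lfun2_sum I (s : seq I) (f : I -> T -> R) :
  (forall i, f i \in L2) -> (fun x => \sum_(i <- s) f i x) \in L2.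
Proof.
move=> fL; elim: s => [|i s ih].
  have -> : (fun x => \sum_(i <- [::]) f i x) = cst 0.
    by apply/funext => x; rewrite big_nil.
  apply/Lfun2P; split => //.
  by under eq_integral do rewrite /= expr0n; rewrite integral0 ltry.
have -> : (fun x => \sum_(j <- i :: s) f j x) =
    (fun x => f i x - (-1) * \sum_(j <- s) f j x).
  by apply/funext => x; rewrite big_cons mulN1r opprK.
exact: Lfun2_subZ.
Qed.

Lemma EFin_Rintegral f : m.-integrable [set: T] (fun x => (f x)%:E) ->
  (\int[m]_x f x)%:E = (\int[m]_x (f x)%:E)%E.
Proof. by move=> fi; rewrite /Rintegral fineK// integrable_fin_num. Qed.

(** The quadratic polynomial in t given by the integral of (f + t g)^2 is non-negative; evaluating
    it at a well-chosen t gives the bound. *)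
Lemma cauchy_schwarz_L2 f g : f \in L2 -> g \in L2 ->
  `|ip f g| <= Num.sqrt (ip f f) * Num.sqrt (ip g g).
Proof.
move=> fL gL.
have ffi := Lfun2_integrable_mul f f fL fL.
have fgi := Lfun2_integrable_mul f g fL gL.
have ggi := Lfun2_integrable_mul g g gL gL.
have ge0 h : 0 <= ip h h.
  by apply: Rintegral_ge0 => x _; rewrite -expr2 sqr_ge0.
have quad (t : R) : 0 <= ip f f + 2 * t * ip f g + t ^+ 2 * ip g g.
  rewrite -!RintegralZl//.
  rewrite -!RintegralD//; last 3 first.
  - exact: (integrableD measurableT ffi (integrableZl measurableT (2 * t) fgi)).
  - exact: (integrableZl measurableT (t ^+ 2) ggi).
  - exact: (integrableZl measurableT (2 * t) fgi).
  apply: Rintegral_ge0 => x _.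
  have -> : f x * f x + 2 * t * (f x * g x) + t ^+ 2 * (g x * g x) =
     (f x + t * g x) ^+ 2 by ring.
  exact: sqr_ge0.
rewrite -sqrtrM// -sqrtr_sqr ler_sqrt ?mulr_ge0//.
have [B0|B0] := eqVneq (ip g g) 0.
  rewrite B0 mulr0; suff -> : ip f g = 0 by rewrite expr0n.
  apply/eqP; apply/negPn/negP => I0.
  (* Here the polynomial is affine with non-zero slope, and this t gives it the value -1. *)
  have := quad (- ((ip f f + 1) / (2 * ip f g))).
  rewrite B0 mulr0 addr0 mulrN mulNr.
  have -> : 2 * ((ip f f + 1) / (2 * ip f g)) * ip f g = ip f f + 1.
    by field.
  lra.
have Bgt0 : 0 < ip g g by rewrite lt_neqAle eq_sym B0 ge0.
(* The minimiser of the polynomial. *)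
have := quad (- (ip f g / ip g g)).
have -> : ip f f + 2 * - (ip f g / ip g g) * ip f g +
  (- (ip f g / ip g g)) ^+ 2 * ip g g = ip f f - ip f g ^+ 2 / ip g g by field.
by rewrite subr_ge0 ler_pdivrMr.
Qed.

(** The limits are only assumed measurable: their square-integrability is part of the conclusion, as
    the response for K = +oo is specified by convergence alone. *)
Lemma Rintegral_mul_cvg f g (f_ g_ : nat -> T -> R) :
  measurable_fun [set: T] f -> measurable_fun [set: T] g ->
  (forall n, f_ n \in L2) -> (forall n, g_ n \in L2) ->
  (\int[m]_x ((f x - f_ n x) ^+ 2)%:E)%E @[n --> \oo] --> 0%E ->
  (\int[m]_x ((g x - g_ n x) ^+ 2)%:E)%E @[n --> \oo] --> 0%E ->
  [/\ f \in L2, g \in L2 & ip (f_ n) (g_ n) @[n --> \oo] --> ip f g].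
Proof.
have cvgL2 (h : T -> R) (h_ : nat -> T -> R) : measurable_fun [set: T] h ->
    (forall n, h_ n \in L2) ->
    (\int[m]_x ((h x - h_ n x) ^+ 2)%:E)%E @[n --> \oo] --> 0%E ->
    h \in L2 /\ Num.sqrt (ip (h \- h_ n) (h \- h_ n)) @[n --> \oo] --> 0.
  move=> mh hL /fine_cvgP[hfin hcvg].
  (* Convergence to 0 in the extended reals makes the integral finite at some index [N], and h = (h
     - h_N) + h_N. *)
  have hL2 : h \in L2.
    case: hfin => N _ /(_ N (leqnn N)) hfin.
    suff : (h \- h_ N) \in L2.
      move=> hN; have -> : h = (h \- h_ N) + h_ N.
        by apply/funext => x; rewrite /GRing.add/= subrK.
      by rewrite rpredD// lee1n.
    apply/Lfun2P; split; last by rewrite ltey_eq hfin.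
    by apply: measurable_funB => //; have /Lfun2P[] := hL N.
  split => //.
  rewrite -[X in _ --> X](@sqrtr0 R).
  apply: (continuous_cvg _ (@sqrt_continuous R 0)).
  apply: cvg_trans hcvg.
  by apply: near_eq_cvg; near=> n.
move=> mf mg fL gL /(cvgL2 _ _ mf fL)[{}mf fcvg] /(cvgL2 _ _ mg gL)[{}mg gcvg].
split => //.
(* The sum of the Cauchy-Schwarz bounds for the three terms of f g - f_n g_n = f (g - g_n) + (f -
   f_n) g - (f - f_n) (g - g_n). *)
pose e n := Num.sqrt (ip f f) * Num.sqrt (ip (g \- g_ n) (g \- g_ n)) +
  Num.sqrt (ip (f \- f_ n) (f \- f_ n)) * Num.sqrt (ip g g) +
  Num.sqrt (ip (f \- f_ n) (f \- f_ n)) * Num.sqrt (ip (g \- g_ n) (g \- g_ n)).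
have e0 : e n @[n --> \oo] --> 0.
  have -> : 0 = Num.sqrt (ip f f) * 0 + 0 * Num.sqrt (ip g g) + 0 * 0 :> R.
    by ring.
  by apply: cvgD; [apply: cvgD|]; apply: cvgM => //; exact: cvg_cst.
apply/cvgrPdist_le => /= eps eps0.
near=> n.
have Dn : (f \- f_ n) \in L2 by rewrite rpredB ?lee1n.
have En : (g \- g_ n) \in L2 by rewrite rpredB ?lee1n.
have -> : ip f g - ip (f_ n) (g_ n) = ip f (g \- g_ n) + ip (f \- f_ n) g -
    ip (f \- f_ n) (g \- g_ n).
  have i1 := Lfun2_integrable_mul f (g \- g_ n) mf En.
  have i2 := Lfun2_integrable_mul (f \- f_ n) g Dn mg.
  have i3 := Lfun2_integrable_mul (f \- f_ n) (g \- g_ n) Dn En.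
  rewrite -RintegralD// -RintegralB//; [|exact: Lfun2_integrable_mul..].
  rewrite -RintegralB//; last exact: (integrableD measurableT i1 i2).
  by apply: eq_Rintegral => x _ /=; ring.
apply: (@le_trans _ _ (e n)).
  apply: (le_trans (ler_normB _ _)); apply: lerD; last exact: cauchy_schwarz_L2.
  apply: (le_trans (ler_normD _ _)); apply: lerD; exact: cauchy_schwarz_L2.
apply: le_trans (ler_norm _) _; rewrite -normrN -[- _]add0r.
near: n.
by move/cvgrPdist_le : e0; apply.
Unshelve. all: by end_near. Qed.

End L2_inner_product.

(** * Fubini for square-integrable functions on a product *)

Section product_L2.
Context {d1 d2} {T1 : measurableType d1} {T2 : measurableType d2}
  {R : realType}.

(** The inner real integral sends infinite values to 0 through [fine]; almost every section of [F]
    is integrable, so this default changes nothing in Fubini's theorem. *)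
Lemma expectation_Rintegral (P : probability T1 R)
    (m : {sigma_finite_measure set T2 -> \bar R}) (F : T1 * T2 -> R) :
  (P \x m)%E.-integrable [set: T1 * T2] (EFin \o F) ->
  ('E_P[fun w => (\int[m]_y F (w, y))%R] = (\int[(P \x m)%E]_z F z)%R%:E)%E.
Proof.
move=> iF; rewrite EFin_Rintegral// -integral12_prod_meas1// unlock.
have mF := measurable_fubini_F iF.
apply: ae_eq_integral => //.
  apply/measurable_EFinP; exact: measurableT_comp mF.
have := ae_integrable1 iF; apply: filterS => w iFw _.
by rewrite EFin_Rintegral.
Qed.

Lemma Lfun2_tensor (m1 : {sigma_finite_measure set T1 -> \bar R})
    (m2 : {sigma_finite_measure set T2 -> \bar R}) (f : T1 -> R) (g : T2 -> R) :
  f \in Lfun m1 2%:E -> g \in Lfun m2 2%:E ->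
  (fun z => f z.1 * g z.2) \in Lfun (m1 \x m2)%E 2%:E.
Proof.
move=> /Lfun2P[mf foo] /Lfun2P[mg goo].
have mfg : measurable_fun [set: T1 * T2] (fun z => f z.1 * g z.2).
  by apply: measurable_funM; exact: measurableT_comp.
apply/Lfun2P; split => //.
rewrite fubini_tonelli1//=; last 2 first.
- by apply/measurable_EFinP; exact: measurable_funX.
- by move=> z; rewrite lee_fin sqr_ge0.
rewrite /fubini_F/=.
have mg2 : measurable_fun [set: T2] (fun y => (g y ^+ 2)%:E).
  by apply/measurable_EFinP; exact: measurable_funX.
have mf2 : measurable_fun [set: T1] (fun y => (f y ^+ 2)%:E).
  by apply/measurable_EFinP; exact: measurable_funX.
under eq_integral => x _.
  under eq_integral do rewrite exprMn EFinM.
  rewrite ge0_integralZl//; last 2 first.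
  - by move=> y _; rewrite lee_fin sqr_ge0.
  - by rewrite lee_fin sqr_ge0.
  over.
rewrite ge0_integralZr//.
- have f2 : (0 <= \int[m1]_x (f x ^+ 2)%:E)%E.
    by apply: integral_ge0 => x _; rewrite lee_fin sqr_ge0.
  by rewrite lte_mul_pinfty// ge0_fin_numE.
- by move=> x _; rewrite lee_fin sqr_ge0.
- by apply: integral_ge0 => x _; rewrite lee_fin sqr_ge0.
Qed.

Lemma Rintegral_tensor (m1 : {sigma_finite_measure set T1 -> \bar R})
    (m2 : {sigma_finite_measure set T2 -> \bar R})
    (f f' : T1 -> R) (g g' : T2 -> R) :
  f \in Lfun m1 2%:E -> f' \in Lfun m1 2%:E ->
  g \in Lfun m2 2%:E -> g' \in Lfun m2 2%:E ->
  \int[(m1 \x m2)%E]_z ((f z.1 * g z.2) * (f' z.1 * g' z.2)) =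
  (\int[m1]_x (f x * f' x)) * (\int[m2]_y (g y * g' y)).
Proof.
move=> fL fL' gL gL'.
have ff := Lfun2_integrable_mul _ _ _ fL fL'.
have gg := Lfun2_integrable_mul _ _ _ gL gL'.
have fg := Lfun2_integrable_mul _ _ _ (Lfun2_tensor _ _ _ _ fL gL)
  (Lfun2_tensor _ _ _ _ fL' gL').
apply: EFin_inj; rewrite EFinM !EFin_Rintegral// -integral12_prod_meas1//.
rewrite /fubini_F/=.
under eq_integral => x _.
  under eq_integral => y _.
    rewrite mulrACA EFinM.
    over.
  rewrite integralZl//.
  over.
rewrite /=.
have /fineK <- : (\int[m2]_x (g x * g' x)%:E)%E \is a fin_num.
  exact: integrable_fin_num.
by rewrite integralZr.
Qed.

End product_L2.

(** * Trigonometric integrals over whole periods *)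

Section trigonometric_integrals.
Context {R : realType}.
Local Notation mu := (@lebesgue_measure R).
Implicit Types (t l : R) (z : int).

Lemma cos_sin_2piz z :
  cos (2 * pi * z%:~R : R) = 1 /\ sin (2 * pi * z%:~R : R) = 0.
Proof.
have nat_case n : cos (2 * pi * n%:R : R) = 1 /\ sin (2 * pi * n%:R : R) = 0.
  have -> : 2 * pi * n%:R = 0 + pi *+ 2 *+ n :> R.
    by rewrite add0r mulr_natr mulr_natl.
  by rewrite (periodicn (@cosD2pi R)) (periodicn (@sinD2pi R)) cos0 sin0.
case: z => n; first exact: nat_case.
rewrite NegzE mulrNz mulrN cosN sinN.
by have [-> ->] := nat_case n.+1; rewrite oppr0.
Qed.

Lemma continuous_cosM t : continuous (fun x : R => cos (t * x)).
Proof.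
move=> x; apply: continuous_comp; last exact: continuous_cos.
exact: mulrl_continuous.
Qed.

Lemma continuous_sinM t : continuous (fun x : R => sin (t * x)).
Proof.
move=> x; apply: continuous_comp; last exact: continuous_sin.
exact: mulrl_continuous.
Qed.

Lemma Rintegral_FTC2 (f F : R -> R) l : 0 < l -> continuous f ->
  (forall x, is_derive x (1 : R) F (f x)) ->
  \int[mu]_(x in `[0, l]) f x = F l - F 0.
Proof.
move=> l0 cf Ff.
have cF (x : R) : {for x, continuous F}.
  by apply: differentiable_continuous; apply/derivable1_diffP; have [] := Ff x.
rewrite /Rintegral (@continuous_FTC2 _ _ F)//.
- exact: continuous_subspaceT.
- split; first by move=> x _; have [] := Ff x.
  + exact/cvg_at_right_filter/cF.
  + exact/cvg_at_left_filter/cF.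
- by move=> x _; rewrite derive1E; exact: (@derive_val _ _ _ _ _ _ _ (Ff x)).
Qed.

(** For z = 0 the frequency t is 0 and the integrands are constant; otherwise the primitives take
    equal values at both ends. The integer is signed because differences of frequencies occur
    below. *)
Lemma Rintegral_cos_sin_2piz l t z : 0 < l -> t * l = 2 * pi * z%:~R ->
  \int[mu]_(x in `[0, l]) cos (t * x) = l * (z == 0)%:R /\
  \int[mu]_(x in `[0, l]) sin (t * x) = 0.
Proof.
move=> l0 tl.
have [z0|z0] := eqVneq z 0.
  have -> : t = 0.
    by move/eqP: tl; rewrite z0 mulr0 mulf_eq0 (gt_eqF l0) orbF => /eqP.
  split.
    under eq_Rintegral do rewrite mul0r cos0.
    rewrite Rintegral_cst//= lebesgue_measure_itv/= lte_fin l0 /=.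
    by rewrite subr0 mul1r mulr1.
  under eq_Rintegral do rewrite mul0r sin0.
  by rewrite Rintegral_cst// mul0r.
have t0 : t != 0.
  apply/eqP => t0; move/eqP : tl; rewrite t0 mul0r eq_sym !mulf_eq0 intr_eq0.
  by rewrite (negbTE z0) pnatr_eq0 (gt_eqF (pi_gt0 _)).
have [c1 s0] := cos_sin_2piz z.
have dsin x : is_derive x (1 : R) (fun x => t^-1 * sin (t * x)) (cos (t * x)).
  by apply: is_derive_eq; rewrite /GRing.scale/=; field.
have dcos x : is_derive x (1 : R) (fun x => - t^-1 * cos (t * x)) (sin (t * x)).
  by apply: is_derive_eq; rewrite /GRing.scale/=; field.
split.
  rewrite (Rintegral_FTC2 _ _ l l0 (continuous_cosM t) dsin).
  by rewrite tl s0 !mulr0 sin0 mulr0 subrr.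
rewrite (Rintegral_FTC2 _ _ l l0 (continuous_sinM t) dcos).
by rewrite tl c1 mulr0 cos0 subrr.
Qed.

Lemma continuous_integrable_itv (f : R -> R) l : continuous f ->
  mu.-integrable `[0, l] (EFin \o f).
Proof.
move=> cf; apply: continuous_compact_integrable; first exact: segment_compact.
exact: continuous_subspaceT.
Qed.

(** Product-to-sum formulas: the integers y and z count the periods of the difference and of the sum
    frequency. Constraining these two, rather than a and b themselves, lets the lemma serve both
    [0, delta] and [0, L], where a single frequency may complete only half-periods. *)
Lemma Rintegral_cos_sin_mul l a b y z : 0 < l ->
  (a - b) * l = 2 * pi * y%:~R -> (a + b) * l = 2 * pi * z%:~R ->
  [/\ \int[mu]_(x in `[0, l]) (cos (a * x) * cos (b * x)) =
        l / 2 * ((y == 0)%:R + (z == 0)%:R),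
      \int[mu]_(x in `[0, l]) (sin (a * x) * sin (b * x)) =
        l / 2 * ((y == 0)%:R - (z == 0)%:R) &
      \int[mu]_(x in `[0, l]) (cos (a * x) * sin (b * x)) = 0].
Proof.
move=> l0 ab1 ab2.
have [C1 S1] := Rintegral_cos_sin_2piz _ _ _ l0 ab1.
have [C2 S2] := Rintegral_cos_sin_2piz _ _ _ l0 ab2.
have ic t := continuous_integrable_itv _ l (continuous_cosM t).
have isn t := continuous_integrable_itv _ l (continuous_sinM t).
have mI : measurable (`[0, l]%classic : set (measurableTypeR R)).
  exact: measurable_itv.
have E x : (a - b) * x = a * x - b * x by ring.
have E' x : (a + b) * x = a * x + b * x by ring.
split.
- under eq_Rintegral => x _.
    have -> : cos (a * x) * cos (b * x) =
       2^-1 * (cos ((a - b) * x) + cos ((a + b) * x)).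
      by rewrite E E' cosB cosD; field.
    over.
  rewrite RintegralZl//; last first.
    exact: (integrableD mI (ic (a - b)) (ic (a + b))).
  by rewrite RintegralD// C1 C2; field.
- under eq_Rintegral => x _.
    have -> : sin (a * x) * sin (b * x) =
       2^-1 * (cos ((a - b) * x) - cos ((a + b) * x)).
      by rewrite E E' cosB cosD; field.
    over.
  rewrite RintegralZl//; last first.
    exact: (integrableB mI (ic (a - b)) (ic (a + b))).
  by rewrite RintegralB// C1 C2; field.
- under eq_Rintegral => x _.
    have -> : cos (a * x) * sin (b * x) =
       2^-1 * (sin ((a + b) * x) - sin ((a - b) * x)).
      by rewrite E E' sinB sinD; field.
    over.
  rewrite RintegralZl//; last first.
    exact: (integrableB mI (isn (a + b)) (isn (a - b))).
  by rewrite RintegralB// S1 S2 subrr mulr0.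
Qed.

End trigonometric_integrals.

(** * Square-integrable functions on an interval *)

Section interval_L2.
Context {R : realType}.
Local Notation mu := (@lebesgue_measure R).
Implicit Types (a b : R) (f g : R -> R).

(** [L2_itv] refers to a restricted measure on the whole line, integrals to the Lebesgue measure on
    the interval; the two measures agree on measurable subsets of the interval. *)
Lemma L2_itv_integrable_mul a b f g : L2_itv a b f -> L2_itv a b g ->
  mu.-integrable `[a, b] (fun x => (f x * g x)%:E).
Proof.
move=> fL gL.
have /integrableP[mfg fgoo] := Lfun2_integrable_mul _ _ _ fL gL.
have mI : measurable (`[a, b]%classic : set (measurableTypeR R)).
  exact: measurable_itv.
apply/integrableP; split.
  exact: measurable_funTS.
apply: le_lt_trans fgoo.
apply: (@le_trans _ _ (\int[mrestr mu (measurable_itv `[a, b])]_(x in `[a, b])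
    `|(f x * g x)%:E|)%E).
  rewrite le_eqVlt; apply/orP; left; apply/eqP.
  by apply: eq_measure_integral => A mA Aab; rewrite /= /mrestr setIidl.
by apply: ge0_subset_integral => //; exact: measurableT_comp.
Qed.

Lemma L2_itv_bounded a b f (M : R) : measurable_fun [set: R] f ->
  (forall x, `|f x| <= M) -> L2_itv a b f.
Proof.
move=> mf fM; apply/Lfun2P; split => //.
apply: (@le_lt_trans _ _
    (\int[mrestr mu (measurable_itv `[a, b])]_x (cst (M ^+ 2)%:E x))%E).
  apply: ge0_le_integral => //.
  - by move=> x _; rewrite lee_fin sqr_ge0.
  - by apply/measurable_EFinP; exact: measurable_funX.
  - move=> x _; rewrite lee_fin -real_normK ?num_real//.
    by rewrite ler_sqr ?nnegrE// (le_trans _ (fM x)).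
rewrite integral_cst//= /mrestr setTI lebesgue_measure_itv/=.
by case: ifP => _; rewrite -?EFinB ?mule0 -?EFinM ltry.
Qed.

Lemma L2_itv_cos a b t : L2_itv a b (fun x => cos (t * x)).
Proof.
apply: (@L2_itv_bounded _ _ _ 1) => [|x].
  by apply: continuous_measurable_fun; exact: continuous_cosM.
by rewrite ler_norml cos_geN1 cos_le1.
Qed.

Lemma L2_itv_sin a b t : L2_itv a b (fun x => sin (t * x)).
Proof.
apply: (@L2_itv_bounded _ _ _ 1) => [|x].
  by apply: continuous_measurable_fun; exact: continuous_sinM.
by rewrite ler_norml sin_geN1 sin_le1.
Qed.

Lemma L2_itv_subZ a b f g t : L2_itv a b f -> L2_itv a b g ->
  L2_itv a b (fun x => f x - t * g x).
Proof. exact: Lfun2_subZ. Qed.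

Lemma eq_inner_itv a b f g h : L2_itv a b f -> L2_itv a b g -> L2_itv a b h ->
  ae_eq mu `[a, b]%classic f g -> inner_itv a b f h = inner_itv a b g h.
Proof.
move=> fL gL hL fg.
have mI : measurable (`[a, b]%classic : set (measurableTypeR R)).
  exact: measurable_itv.
congr fine; apply: (ae_eq_integral _ _ mI).
- exact: measurable_int (L2_itv_integrable_mul _ _ _ _ fL hL).
- exact: measurable_int (L2_itv_integrable_mul _ _ _ _ gL hL).
- by apply: filterS fg => x fgx xab; rewrite fgx.
Qed.

Lemma inner_itv_eq0 a b f : L2_itv a b f ->
  inner_itv a b f f = 0 -> ae_eq mu `[a, b]%classic f (cst 0).
Proof.
move=> fL f0.
have ffi := L2_itv_integrable_mul _ _ _ _ fL fL.
have mI : measurable (`[a, b]%classic : set (measurableTypeR R)).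
  exact: measurable_itv.
have : ae_eq mu `[a, b]%classic (fun x => (f x * f x)%:E) (cst 0%E).
  apply/ae_eq_integral_abs => //; first exact: measurable_int ffi.
  under eq_integral do rewrite gee0_abs ?lee_fin -?expr2 ?sqr_ge0//.
  (* A real integral equal to 0 could also stem from an infinite one through [fine]; [ffi] excludes
     this. *)
  rewrite -[LHS]fineK; last first.
    exact: (integrable_fin_num mI ffi).
  by move: f0; rewrite /inner_itv/Rintegral => ->.
apply: filterS => x /[apply] /eqP; rewrite /= eqe mulf_eq0 orbb => /eqP.
exact.
Qed.

End interval_L2.

(** * Responses to the partial sums, mode by mode *)

Section response.
Context {d : measure_display} {T : measurableType d} {R : realType}.
Local Notation mu := (@lebesgue_measure R).
Local Notation normc := ComplexField.Normc.normc.
Variables (P : probability T R) (X : nat -> {RV P >-> R}).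
Variables (delta alpha : R) (bhat : R -> R[i]).
Local Notation theta := (freq delta).
Implicit Types (phi psi : R -> R) (k : nat).

Definition cos_coef phi k := inner_itv 0 delta phi (fun s => cos (theta k * s)).
Definition sin_coef phi k := inner_itv 0 delta phi (fun s => sin (theta k * s)).

(* The coefficient of X_k in R_phi[u]. *)
Definition response_mode phi k (x : R) : R :=
  let p := complex.Re (bhat (theta k)) + complex.Im (bhat (theta k)) in
  let q := complex.Re (bhat (theta k)) - complex.Im (bhat (theta k)) in
  k%:R `^ (- alpha) *
    ((p * cos_coef phi k - q * sin_coef phi k) * cos (theta k * x) +
     (p * sin_coef phi k + q * cos_coef phi k) * sin (theta k * x)).

(** The factors at t and -t are conjugate, so with [bhat t] = a + i b the cosine goes to a cos - b
    sin and the sine to a sin + b cos, which are then added. *)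
Lemma Re_symbol_cossin (t y : R) : hermitian_symmetric bhat ->
  complex.Re (symbol_cossin bhat t y) =
  (complex.Re (bhat t) + complex.Im (bhat t)) * cos (t * y) +
  (complex.Re (bhat t) - complex.Im (bhat t)) * sin (t * y).
Proof.
move=> bhatN; rewrite /symbol_cossin /symbol_exp bhatN /expi mulNr cosN sinN.
have -> : (2 : R[i])^-1 = Complex 2^-1 0.
  by rewrite -[2 in LHS](rmorph_nat (real_complex R)) -fmorphV.
have -> : (2 * Complex 0 1 : R[i])^-1 = Complex 0 (- 2^-1).
  have i2 : (2 : R[i]) = Complex 2 0.
    by rewrite -[LHS](rmorph_nat (real_complex R)).
  apply: (@mulfI _ (2 * Complex 0 1)).
    by rewrite i2 eq_complex /= !mulr1 !mulr0 subrr addr0 pnatr_eq0 andbF.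
  rewrite divff; last first.
    by rewrite i2 eq_complex /= !mulr1 !mulr0 subrr addr0 pnatr_eq0 andbF.
  by apply/eqP; rewrite i2 eq_complex /=; apply/andP; split; apply/eqP; field.
by case: (bhat t) => a b /=; field.
Qed.

Lemma response_partialE phi n w x : hermitian_symmetric bhat ->
  L2_itv 0 delta phi ->
  response_partial X delta alpha bhat phi n w x =
  \sum_(1 <= k < n.+1) X k w * response_mode phi k x.
Proof.
move=> bhatN phiL.
have mI : measurable (`[0, delta]%classic : set (measurableTypeR R)).
  exact: measurable_itv.
have ic k := L2_itv_integrable_mul _ _ _ _ phiL (L2_itv_cos 0 delta (theta k)).
have isn k := L2_itv_integrable_mul _ _ _ _ phiL (L2_itv_sin 0 delta (theta k)).
pose p k := complex.Re (bhat (theta k)) + complex.Im (bhat (theta k)).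
pose q k := complex.Re (bhat (theta k)) - complex.Im (bhat (theta k)).
pose c k := X k w * k%:R `^ (- alpha).
(* After the addition formulas at x - s, [a k] and [b k] multiply the cosine and the sine in s;
   integrating against phi and regrouping in x yields [response_mode]. *)
pose a k := c k * (p k * cos (theta k * x) + q k * sin (theta k * x)).
pose b k := c k * (p k * sin (theta k * x) - q k * cos (theta k * x)).
rewrite /response_partial.
transitivity (\int[mu]_(s in `[0, delta]) (\sum_(1 <= k < n.+1)
    (a k * (phi s * cos (theta k * s)) + b k * (phi s * sin (theta k * s))))).
  apply: eq_Rintegral => s _.
  rewrite /g_partial /Bu_partial mulr_sumr; apply: eq_bigr => k _.
  rewrite Re_symbol_cossin// mulrBr cosB sinB -/(p k) -/(q k) /a /b /c; ring.
have iab k : mu.-integrable `[0, delta] (EFin \o (fun s =>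
    a k * (phi s * cos (theta k * s)) + b k * (phi s * sin (theta k * s)))).
  exact: (integrableD mI (integrableZl mI (a k) (ic k))
    (integrableZl mI (b k) (isn k))).
rewrite (Rintegral_sum _ _ _ _ _ mI iab); apply: eq_bigr => k _.
rewrite RintegralD//; last 2 first.
- exact: (integrableZl mI (a k) (ic k)).
- exact: (integrableZl mI (b k) (isn k)).
have {}ic := ic k; have {}isn := isn k.
rewrite !RintegralZl// /response_mode /= -/(p k) -/(q k).
rewrite -[Rintegral _ _ _]/(cos_coef phi k).
by rewrite -[Rintegral _ _ _]/(sin_coef phi k) /a /b /c; ring.
Qed.

Lemma continuous_response_mode phi k : continuous (response_mode phi k).
Proof.
move=> x; apply: cvgM; first exact: cvg_cst.
apply: cvgD; apply: cvgM; [exact: cvg_cst| exact: continuous_cosM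
  | exact: cvg_cst | exact: continuous_sinM].
Qed.

(** Up to the power of k, the coefficients in x arise from the pair (C, S) of coefficients of phi by
    the matrix with rows (p, - q) and (q, p). It scales inner products by p^2 + q^2 = 2
    |bhat(theta_k)|^2, and L / 2 is the square norm of the cosine and of the sine. *)
Lemma inner_response_mode (L : R) phi psi k : 0 < delta -> 0 < L -> (0 < k)%N ->
  (exists m : nat, 2 * L / delta = m%:R) ->
  inner_itv 0 L (response_mode phi k) (response_mode psi k) =
  L * normc (bhat (theta k)) ^+ 2 * (k%:R `^ (- alpha)) ^+ 2 *
    (cos_coef phi k * cos_coef psi k + sin_coef phi k * sin_coef psi k).
Proof.
move=> delta0 L0 k0 [m Lm].
have m0 : (0 < m)%N.
  by rewrite -(ltr0n R) -Lm !mulr_gt0// invr_gt0.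
have [cc ss cs] : [/\
  \int[mu]_(x in `[0, L]) (cos (theta k * x) * cos (theta k * x)) = L / 2,
  \int[mu]_(x in `[0, L]) (sin (theta k * x) * sin (theta k * x)) = L / 2 &
  \int[mu]_(x in `[0, L]) (cos (theta k * x) * sin (theta k * x)) = 0].
  have h1 : (theta k - theta k) * L = 2 * pi * (0 : int)%:~R.
    by rewrite subrr mul0r mulr0.
  (* The doubled frequency completes k m periods on [0, L], since m = 2 L / delta; k m is positive,
     so its integral vanishes. *)
  have h2 : (theta k + theta k) * L = 2 * pi * ((k * m)%N : int)%:~R.
    rewrite -[X in 2 * pi * X]/((k * m)%N%:R) natrM -Lm /freq; field.
    by rewrite gt_eqF.
  have [] := Rintegral_cos_sin_mul _ _ _ _ _ L0 h1 h2.
  have -> : (((k * m)%N : int) == 0) = false.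
    by apply/negbTE; rewrite -lt0n muln_gt0 k0.
  by rewrite eqxx addr0 subr0 mulr1.
have mI : measurable (`[0, L]%classic : set (measurableTypeR R)).
  exact: measurable_itv.
have cL := L2_itv_cos 0 L (theta k); have sL := L2_itv_sin 0 L (theta k).
have icc := L2_itv_integrable_mul _ _ _ _ cL cL.
have iss := L2_itv_integrable_mul _ _ _ _ sL sL.
have ics := L2_itv_integrable_mul _ _ _ _ cL sL.
rewrite /inner_itv /response_mode /=.
set p := complex.Re _ + complex.Im _; set q := complex.Re _ - complex.Im _.
set c := _ `^ _.
set C := cos_coef phi k; set S := sin_coef phi k.
set C' := cos_coef psi k; set S' := sin_coef psi k.
pose A := c * (p * C - q * S); pose A' := c * (p * C' - q * S').
pose B := c * (p * S + q * C); pose B' := c * (p * S' + q * C').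
transitivity (\int[mu]_(x in `[0, L])
   (A * A' * (cos (theta k * x) * cos (theta k * x)) +
    B * B' * (sin (theta k * x) * sin (theta k * x)) +
    (A * B' + A' * B) * (cos (theta k * x) * sin (theta k * x)))).
  by apply: eq_Rintegral => x _; rewrite /A /A' /B /B'; ring.
have i1 := integrableZl mI (A * A') icc.
have i2 := integrableZl mI (B * B') iss.
have i3 := integrableZl mI (A * B' + A' * B) ics.
rewrite RintegralD//; last exact: (integrableD mI i1 i2).
rewrite RintegralD// !RintegralZl// cc ss cs mulr0 addr0.
have -> : normc (bhat (theta k)) ^+ 2 = (p ^+ 2 + q ^+ 2) / 2.
  rewrite /p /q; case: (bhat _) => u v /=.
  by rewrite sqr_sqrtr ?addr_ge0 ?sqr_ge0//; field.
by rewrite /A /A' /B /B'; field.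
Qed.

End response.

(** Extension by zero replaces [0, L] by the whole line, so that the tensor lemmas apply to
    [P \x mu]. *)
Lemma Lfun2_restrict_itv {R : realType} (a b : R) (h : R -> R) :
  measurable_fun [set: R] h -> L2_itv a b h ->
  (h \_ `[a, b]) \in Lfun (@lebesgue_measure R) 2%:E.
Proof.
move=> mh hL.
have mI : measurable (`[a, b]%classic : set (measurableTypeR R)).
  exact: measurable_itv.
apply/Lfun2P; split.
  by apply/(measurable_restrictT _ mI); exact: measurable_funTS.
have /integrableP[_] := L2_itv_integrable_mul _ _ _ _ hL hL.
apply: le_lt_trans; rewrite [leRHS]integral_mkcond.
rewrite le_eqVlt; apply/orP; left; apply/eqP.
apply: eq_integral => x _; rewrite !patchE; case: ifPn => // _.
  by rewrite gee0_abs ?lee_fin -?expr2 ?sqr_ge0.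
by rewrite expr0n.
Qed.

(** * Covariance of the responses *)

Section response_covariance.
Context {d : measure_display} {T : measurableType d} {R : realType}.
Local Notation mu := (@lebesgue_measure R).
Local Notation normc := ComplexField.Normc.normc.
Variables (P : probability T R) (X : nat -> {RV P >-> R}).
Variables (delta L alpha : R) (K : option nat) (bhat : R -> R[i]).
Local Notation theta := (freq delta).
Implicit Types (phi psi : R -> R) (k n : nat).
Hypotheses (delta_gt0 : 0 < delta) (L_gt0 : 0 < L).
Hypotheses (X_indep : mutually_independent X (mode K))
    (X_normal : forall k, mode K k -> standard_normal X k)
    (bhat_hermitian : hermitian_symmetric bhat)
    (L_delta : exists m : nat, 2 * L / delta = m%:R).

(** The expansion of <Lop phi, psi> truncated to the first n modes. *)
Definition covariance_form n phi psi : R := \sum_(1 <= k < n.+1)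
  L * normc (bhat (theta k)) ^+ 2 * (k%:R `^ (- alpha)) ^+ 2 *
    (cos_coef delta phi k * cos_coef delta psi k +
     sin_coef delta phi k * sin_coef delta psi k).

Local Notation h := (response_mode delta alpha bhat).

(** Written as a sum of tensors on the product space, so that its integrals factor;
    [response_restrictE] identifies it with the response extended by zero. *)
Definition response_restrict n phi (z : T * R) : R :=
  \sum_(1 <= k < n.+1) X k z.1 * ((h phi k) \_ `[0, L]) z.2.

Lemma response_restrictE n phi w x : L2_itv 0 delta phi ->
  response_restrict n phi (w, x) =
  ((response_partial X delta alpha bhat phi n w) \_ `[0, L]) x.
Proof.
move=> phiL; rewrite /response_restrict /= patchE; case: ifPn => xL.
  rewrite response_partialE//; apply: eq_bigr => k _.
  by rewrite patchE xL.
by rewrite big1// => k _; rewrite patchE (negbTE xL) mulr0.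
Qed.

Lemma measurable_response_mode phi k : measurable_fun [set: R] (h phi k).
Proof.
by apply: continuous_measurable_fun; exact: continuous_response_mode.
Qed.

Lemma L2_itv_response_mode phi k : L2_itv 0 L (h phi k).
Proof.
pose p := complex.Re (bhat (theta k)) + complex.Im (bhat (theta k)).
pose q := complex.Re (bhat (theta k)) - complex.Im (bhat (theta k)).
set a := p * cos_coef delta phi k - q * sin_coef delta phi k.
set b := p * sin_coef delta phi k + q * cos_coef delta phi k.
apply: (@L2_itv_bounded _ _ _ _ (`|k%:R `^ (- alpha)| * (`|a| + `|b|))) => [|x].
  exact: measurable_response_mode.
rewrite /response_mode /= -/p -/q -/a -/b normrM ler_wpM2l//.
apply: le_trans (ler_normD _ _) _; rewrite !normrM.
apply: lerD; rewrite ler_piMr// ler_norml.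
  by rewrite cos_geN1 cos_le1.
by rewrite sin_geN1 sin_le1.
Qed.

(** The double sum of tensors factors termwise into E[X_k X_l] times an inner product on [0, L].
    Only k = l survives, and [inner_response_mode] evaluates these terms. *)
Lemma Rintegral_response_restrict n phi psi :
  (forall k, (0 < k <= n)%N -> mode K k) ->
  response_restrict n phi \in Lfun (P \x mu)%E 2%:E /\
  \int[(P \x mu)%E]_z (response_restrict n phi z * response_restrict n psi z) =
  covariance_form n phi psi.
Proof.
move=> nK.
(* Indexing by ordinals, shifted by 1, builds the bound into the index type, so that every term is a
   mode without a side condition. *)
have modeS (i : 'I_n) : mode K i.+1 by apply: nK; rewrite /= ltn_ord.
have XL (i : 'I_n) := Lfun2_standard_normal P X _ X_normal i.+1 (modeS i).
have hL f k := Lfun2_restrict_itv _ _ _ (measurable_response_mode f k)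
  (L2_itv_response_mode f k).
have resE f : response_restrict n f =
    fun z => \sum_(i < n) X i.+1 z.1 * ((h f i.+1) \_ `[0, L]) z.2.
  by apply/funext => z; rewrite /response_restrict big_add1 big_mkord.
have tL f (i : 'I_n) := Lfun2_tensor P mu _ _ (XL i) (hL f i.+1).
split; first by rewrite resE; exact: (Lfun2_sum _ _ _ _ (tL phi)).
rewrite !resE /covariance_form big_add1 big_mkord.
have tt (i j : 'I_n) := Lfun2_integrable_mul _ _ _ (tL phi i) (tL psi j).
under eq_Rintegral do rewrite mulr_suml.
rewrite Rintegral_sum//=; last first.
  move=> i; apply: Lfun2_integrable_mul; first exact: tL.
  exact: (Lfun2_sum _ _ _ _ (tL psi)).
apply: eq_bigr => i _.
under eq_Rintegral do rewrite mulr_sumr.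
rewrite Rintegral_sum//=; last exact: (tt i).
have XX (j : 'I_n) : \int[P]_w (X i.+1 w * X j.+1 w) = (i == j)%:R.
  rewrite /Rintegral; case: eqVneq => [<-|ij].
    under eq_integral do rewrite -expr2.
    by rewrite (moment2_standard_normal P X _ X_normal).
  by rewrite (integral_mul_independent P X _ X_indep X_normal)// eqSS.
under eq_bigr do rewrite Rintegral_tensor// XX.
rewrite (bigD1 i)//= eqxx mul1r big1 ?addr0; last first.
  by move=> j ji; rewrite eq_sym (negbTE ji) mul0r.
rewrite -inner_response_mode// /inner_itv Rintegral_mkcond.
apply: eq_Rintegral => x _; rewrite !patchE.
by case: ifPn => // _; rewrite mulr0.
Qed.

(** * Passage from the truncated form to the operator *)

Section interaction_operator.
Variables (Rf : (R -> R) -> T -> R -> R) (Lop : (R -> R) -> R -> R).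
Hypotheses (Rf_response : forall phi, L2_itv 0 delta phi ->
       is_response X delta L alpha bhat K phi (Rf phi))
    (Lop_def : is_interaction_operator P delta L Rf Lop).

Let F phi (z : T * R) : R := ((Rf phi z.1) \_ `[0, L]) z.2.

Lemma inner_interaction_operator phi psi :
  L2_itv 0 delta phi -> L2_itv 0 delta psi ->
  F phi \in Lfun (P \x mu)%E 2%:E -> F psi \in Lfun (P \x mu)%E 2%:E ->
  inner_itv 0 delta (Lop phi) psi = \int[(P \x mu)%E]_z (F phi z * F psi z).
Proof.
move=> phiL psiL FphiL FpsiL.
have [_ /(_ psi psiL) E] := Lop_def phi phiL.
apply: EFin_inj; rewrite E -expectation_Rintegral; last first.
  exact: Lfun2_integrable_mul.
congr expectation; apply/funext => w.
rewrite /inner_itv Rintegral_mkcond.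
apply: eq_Rintegral => x _; rewrite /F /= !patchE.
by case: ifPn => // _; rewrite mulr0.
Qed.

(** For finite K the form at n = K is exact. For K = +oo it converges to <Lop phi, psi>, and being
    constant from [n0] on identifies the limit; this covers every test below, since the form is
    stationary once one argument is a Fourier mode. *)
Lemma interaction_operator_form phi psi n0 (c : R) :
  L2_itv 0 delta phi -> L2_itv 0 delta psi ->
  (forall n, (if K is Some k then n == k else (n0 <= n)%N) ->
    covariance_form n phi psi = c) ->
  inner_itv 0 delta (Lop phi) psi = c.
Proof.
move=> phiL psiL.
have := Rf_response phi phiL; have := Rf_response psi psiL.
have := Rintegral_response_restrict; rewrite /is_response.
case: K => [n|] QE Rpsi Rphi qc.
  have FE f : L2_itv 0 delta f ->
      (forall w x, x \in `[0, L] ->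
        Rf f w x = response_partial X delta alpha bhat f n w x) ->
      F f = response_restrict n f.
    move=> fL Rfn; apply/funext => -[w x].
    rewrite response_restrictE// /F/= !patchE.
    by case: ifPn => // xL; rewrite Rfn//; move: xL; rewrite inE.
  have nK k : (0 < k <= n)%N -> mode (Some n) k by [].
  have [phiR phipsi] := QE n phi psi nK; have [psiR _] := QE n psi psi nK.
  by rewrite inner_interaction_operator// !FE// phipsi qc.
have nK n k : (0 < k <= n)%N -> mode None k by rewrite /mode andbT => /andP[].
have rL f n : response_restrict n f \in Lfun (P \x mu)%E 2%:E.
  by have [] := QE n f f (nK n).
have FE f : measurable_fun (setT `*` `[0, L]) (fun p : T * R => Rf f p.1 p.2) ->
    measurable_fun [set: T * measurableTypeR R] (F f).
  move=> mf.
  have mI : measurable (setT `*` `[0, L]%classic : set (T * measurableTypeR R)).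
    by apply: measurableX => //; exact: measurable_itv.
  have -> : F f = (fun p : T * R => Rf f p.1 p.2) \_ (setT `*` `[0, L]).
    apply/funext => -[w x]; rewrite /F/= !patchE/=.
    have -> // : ((w, x) \in [set: T] `*` `[0, L]) = (x \in `[0, L]%classic).
    by apply/idP/idP => /set_mem xL; apply/mem_set; [case: xL|split].
  exact/(measurable_restrictT _ mI).
(* By Tonelli, the iterated integral in [is_response] is a square norm on the product space. *)
have Fcvg f : L2_itv 0 delta f ->
   measurable_fun [set: T * measurableTypeR R] (F f) ->
   (\int[P]_w \int[mu]_(x in `[0%R, L])
        ((Rf f w x - response_partial X delta alpha bhat f n w x) ^+ 2)%:E)%E
      @[n --> \oo] --> 0%E ->
   (\int[(P \x mu)%E]_z ((F f z - response_restrict n f z) ^+ 2)%:E)%E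
     @[n --> \oo] --> 0%E.
  move=> fL mF; apply: cvg_trans; apply: near_eq_cvg; apply: nearW => n.
  apply/esym.
  have [mr _] := (Lfun2P _ _).1 (rL f n).
  rewrite fubini_tonelli1//; last 2 first.
  - by apply/measurable_EFinP; apply: measurable_funX; exact: measurable_funB.
  - by move=> z; rewrite lee_fin sqr_ge0.
  apply: eq_integral => w _; rewrite integral_mkcond; apply: eq_integral => x _.
  rewrite response_restrictE// /F/= !patchE; case: ifPn => // _.
  by rewrite subrr expr0n.
case: Rpsi => /FE mpsi /(Fcvg _ psiL mpsi) cpsi.
case: Rphi => /FE mphi /(Fcvg _ phiL mphi) cphi.
have [FphiL FpsiL cv] :=
  Rintegral_mul_cvg _ _ _ _ _ mphi mpsi (rL phi) (rL psi) cphi cpsi.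
rewrite inner_interaction_operator//.
apply: (cvg_unique _ cv) => //.
apply: cvg_near_cst; near=> n.
have [_ ->] := QE n phi psi (nK n); apply: qc; near: n; exact: nbhs_infty_ge.
Unshelve. all: by end_near. Qed.

End interaction_operator.

End response_covariance.

(** * The Fourier modes as test functions, and the decay of the eigenvalues *)

Section Fourier_modes.
Context {R : realType}.
Local Notation mu := (@lebesgue_measure R).
Local Notation normc := ComplexField.Normc.normc.
Variables (delta : R) (delta_gt0 : 0 < delta).
Local Notation theta := (freq delta).
Implicit Types (phi psi : R -> R) (j k n : nat).

Definition cos_mode j (s : R) := cos (theta j * s).
Definition sin_mode j (s : R) := sin (theta j * s).

(** The difference and the sum of the frequencies complete j - k and j + k periods on [0, delta];
    the latter is never 0 for positive indices, so only j = k contributes. *)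
Lemma coef_modes j k : (0 < j)%N -> (0 < k)%N ->
  [/\ cos_coef delta (cos_mode j) k = delta / 2 * (j == k)%:R,
      sin_coef delta (cos_mode j) k = 0,
      cos_coef delta (sin_mode j) k = 0 &
      sin_coef delta (sin_mode j) k = delta / 2 * (j == k)%:R].
Proof.
move=> j0 k0.
have h1 a b :
    (theta a - theta b) * delta = 2 * pi * ((a : int) - (b : int))%:~R.
  by rewrite rmorphB /= /freq -!pmulrn; field; rewrite gt_eqF.
have h2 a b :
    (theta a + theta b) * delta = 2 * pi * ((a : int) + (b : int))%:~R.
  by rewrite rmorphD /= /freq -!pmulrn; field; rewrite gt_eqF.
have jk0 : ((j : int) + (k : int) == 0) = false.
  by apply/negbTE; rewrite -PoszD eqz_nat addn_eq0 negb_and -!lt0n j0.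
have jk : ((j : int) - (k : int) == 0) = (j == k) by rewrite subr_eq0 eqz_nat.
have [cc ss cs] := Rintegral_cos_sin_mul _ _ _ _ _ delta_gt0 (h1 j k) (h2 j k).
have [_ _ sc] := Rintegral_cos_sin_mul _ _ _ _ _ delta_gt0 (h1 k j) (h2 k j).
rewrite jk0 jk addr0 in cc; rewrite jk0 jk subr0 in ss.
split => //.
by rewrite -[RHS]sc; apply: eq_Rintegral => x _; rewrite /sin_mode mulrC.
Qed.

Lemma L2_itv_cos_mode j : L2_itv 0 delta (cos_mode j).
Proof. exact: L2_itv_cos. Qed.

Lemma L2_itv_sin_mode j : L2_itv 0 delta (sin_mode j).
Proof. exact: L2_itv_sin. Qed.

Variables (L alpha : R) (bhat : R -> R[i]).
Local Notation lam := (lambda delta L alpha bhat).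
Local Notation form := (covariance_form delta L alpha bhat).

Lemma covariance_formC n phi psi : form n phi psi = form n psi phi.
Proof.
apply: eq_bigr => k _; congr (_ * _).
by rewrite mulrC [X in _ + X = _]mulrC.
Qed.

(** By orthogonality only the summand k = j survives, and the factor delta / 2 completes it to
    [lam j]. The value does not depend on n, as [interaction_operator_form] requires. *)
Lemma covariance_form_mode n j phi : (0 < j <= n)%N ->
  form n phi (cos_mode j) = lam j * cos_coef delta phi j /\
  form n phi (sin_mode j) = lam j * sin_coef delta phi j.
Proof.
case/andP => j0 jn.
have jin : j \in index_iota 1 n.+1 by rewrite mem_index_iota j0.
have E : (j%:R `^ (- alpha)) ^+ 2 = j%:R `^ (- (2 * alpha)) :> R.
  by rewrite -powR_mulrn ?powR_ge0// -powRrM mulNr mulrC.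
split; rewrite /covariance_form (bigD1_seq j) ?iota_uniq//= big_nat_cond;
  rewrite big1 ?addr0.
- have [-> -> _ _] := coef_modes j j j0 j0.
  by rewrite eqxx mulr1 E /lambda; field.
- move=> k /andP[/andP[k0 _] kj]; have [-> -> _ _] := coef_modes j k j0 k0.
  by rewrite eq_sym (negbTE kj) !mulr0 addr0 mulr0.
- have [_ _ -> ->] := coef_modes j j j0 j0.
  by rewrite eqxx mulr1 E /lambda; field.
- move=> k /andP[/andP[k0 _] kj]; have [_ _ -> ->] := coef_modes j k j0 k0.
  by rewrite eq_sym (negbTE kj) !mulr0 addr0 mulr0.
Qed.

(** Since theta_j is a fixed multiple of j, the bounds on the symbol become bounds in j as soon as
    theta_j >= M. *)
Lemma lambda_decay rho : 0 < L -> polynomial_decay bhat rho ->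
  exists c1 c2 : R, [/\ 0 < c1, c1 <= c2 &
     \forall j \near \oo,
       c1 * j%:R `^ (- (2 * (alpha + rho))) <= lam j
       <= c2 * j%:R `^ (- (2 * (alpha + rho)))].
Proof.
move=> L0 [c1 [c2 [M [c10 c12 Mc]]]].
pose c := 2 * pi / delta.
have c0 : 0 < c by rewrite !mulr_gt0 ?pi_gt0// invr_gt0.
(* The constant for [lam] that corresponds to a constant t for the symbol, from theta_j^(- rho) =
   c^(- rho) j^(- rho). *)
pose e (t : R) := L * delta / 2 * (t * c `^ (- rho)) ^+ 2.
have e0 : 0 < L * delta / 2 by rewrite !mulr_gt0// invr_gt0.
have cr : 0 < c `^ (- rho) by exact: powR_gt0.
have c20 : 0 < c2 by exact: lt_le_trans c12.
exists (e c1), (e c2); split.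
- by rewrite mulr_gt0// exprn_gt0// mulr_gt0.
- rewrite ler_wpM2l ?(ltW e0)// ler_sqr ?nnegrE ?ler_wpM2r//.
  + exact: ltW.
  + by rewrite mulr_ge0 ?(ltW cr)// ltW.
  + by rewrite mulr_ge0 ?(ltW cr)// ltW.
have : \forall j \near \oo, M / c <= (j%:R : R) by exact: nbhs_infty_ger.
apply: filter_app; near=> j => Mj.
have j0 : 0 < (j%:R : R) by rewrite ltr0n; near: j; exact: nbhs_infty_gt.
have fE : theta j = c * j%:R by rewrite /freq /c mulrAC.
have f0 : 0 < theta j by rewrite fE mulr_gt0.
have /Mc : M <= `|theta j| by rewrite gtr0_norm// fE mulrC -ler_pdivrMr.
rewrite gtr0_norm// fE powRM ?(ltW c0) ?(ltW j0)//.
set B := normc _; set J := j%:R `^ (- rho) => /andP[B1 B2].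
have J0 : 0 < J by exact: powR_gt0.
have eE t : e t * j%:R `^ (- (2 * (alpha + rho))) =
    L * delta / 2 * (t * (c `^ (- rho) * J)) ^+ 2 * j%:R `^ (- (2 * alpha)).
  have -> : - (2 * (alpha + rho)) = - (2 * alpha) + (- rho) * 2%:R by ring.
  rewrite powRD; last by rewrite (gt_eqF j0) implybT.
  by rewrite powRrM powR_mulrn ?powR_ge0// /e -/J; ring.
have A0 : 0 <= j%:R `^ (- (2 * alpha)) :> R by exact: powR_ge0.
have B0 : 0 <= B by apply: le_trans B1; rewrite !mulr_ge0// ltW.
rewrite !eE /lambda fE -/B; apply/andP; split.
  rewrite ler_wpM2r// ler_wpM2l ?(ltW e0)// ler_sqr ?nnegrE//.
  by rewrite !mulr_ge0// ltW.
rewrite ler_wpM2r// ler_wpM2l ?(ltW e0)// ler_sqr ?nnegrE//.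
by rewrite !mulr_ge0// ltW.
Unshelve. all: by end_near. Qed.

End Fourier_modes.

(** * Non-zero eigenvalues of the interaction operator and their polynomial decay *)

Theorem lemma2p3 (R : realType) (d : measure_display) (T : measurableType d)
    (P : probability T R) (X : nat -> {RV P >-> R})
    (delta L alpha : R) (K : option nat)
    (B : (R -> R[i]) -> R -> R[i]) (bhat : R -> R[i])
    (Rf : (R -> R) -> T -> R -> R) (Lop : (R -> R) -> R -> R)
    (delta_gt0 : 0 < delta) (L_gt0 : 0 < L) (alpha_gt0 : 0 < alpha)
    (X_indep : mutually_independent X (mode K))
    (X_normal : forall k, mode K k -> standard_normal X k)
    (B_bounded : bounded_linear_op B)
    (B_invariant : translation_invariant B)
    (B_symbol : fourier_symbol B bhat)
    (bhat_hermitian : hermitian_symmetric bhat)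
    (L_delta : exists m : nat, 2 * L / delta = m%:R)
    (Rf_response : forall phi, L2_itv 0 delta phi ->
       is_response X delta L alpha bhat K phi (Rf phi))
    (Lop_def : is_interaction_operator P delta L Rf Lop) :
  (forall m : R, m != 0 ->
     (eigenvalue_L2 0 delta Lop m <->
      exists2 j : nat, mode K j & m = lambda delta L alpha bhat j)) /\
  (K = None -> forall rho : R, polynomial_decay bhat rho ->
     exists c1 c2 : R, [/\ 0 < c1, c1 <= c2 &
       \forall j \near \oo,
         c1 * j%:R `^ (- (2 * (alpha + rho)))
         <= lambda delta L alpha bhat j
         <= c2 * j%:R `^ (- (2 * (alpha + rho)))]).
Proof.
split; last first.
  move=> _ rho; exact: lambda_decay.
have form := interaction_operator_form P X delta L alpha K bhat delta_gt0 L_gt0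
  X_indep X_normal bhat_hermitian L_delta Rf Lop Rf_response Lop_def.
(* With [n0] = j, every n at which the form is evaluated reaches the mode j: either n = K >= j, or K
   = +oo and n >= j. *)
have modeP n j : mode K j -> (if K is Some k then n == k else (j <= n)%N) ->
    (0 < j <= n)%N.
  by rewrite /mode; case: (K) => [k|] /andP[-> //] jk /eqP ->.
have testc j phi : mode K j -> L2_itv 0 delta phi ->
    inner_itv 0 delta (Lop phi) (cos_mode delta j) =
    lambda delta L alpha bhat j * cos_coef delta phi j.
  move=> Kj phiL; apply: (form _ _ j) => //; first exact: L2_itv_cos_mode.
  move=> n /(modeP _ _ Kj) jn.
  by have [] := covariance_form_mode delta delta_gt0 L alpha bhat n j phi jn.
have tests j phi : mode K j -> L2_itv 0 delta phi ->
    inner_itv 0 delta (Lop phi) (sin_mode delta j) =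
    lambda delta L alpha bhat j * sin_coef delta phi j.
  move=> Kj phiL; apply: (form _ _ j) => //; first exact: L2_itv_sin_mode.
  move=> n /(modeP _ _ Kj) jn.
  by have [] := covariance_form_mode delta delta_gt0 L alpha bhat n j phi jn.
have innerZ phi psi (t : R) : L2_itv 0 delta phi -> L2_itv 0 delta psi ->
    inner_itv 0 delta (fun s => t * phi s) psi = t * inner_itv 0 delta phi psi.
  move=> phiL psiL; rewrite /inner_itv -RintegralZl//; last first.
    exact: L2_itv_integrable_mul.
  by apply: eq_Rintegral => x _; rewrite mulrA.
move=> m m0; split.
  move=> [phi [phiL phi0 Lphi]].
  have [LphiL _] := Lop_def phi phiL.
  have mphiL : L2_itv 0 delta (fun s => m * phi s) by exact: Lfun2Z.
  have Lm psi : L2_itv 0 delta psi ->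
      inner_itv 0 delta (Lop phi) psi = m * inner_itv 0 delta phi psi.
    move=> psiL; rewrite -innerZ//; exact: eq_inner_itv.
  (* If m is no [lambda] value, testing on the modes gives (m - lambda_j) times each coefficient of
     phi equal to 0, so all coefficients vanish. *)
  apply: contrapT => nj.
  have lam_neq j : mode K j -> m - lambda delta L alpha bhat j != 0.
    by move=> Kj; rewrite subr_eq0; apply/eqP => mj; apply: nj; exists j.
  have C0 j : mode K j -> cos_coef delta phi j = 0.
    move=> Kj; have := testc j phi Kj phiL.
    rewrite Lm; last exact: L2_itv_cos_mode.
    move/eqP; rewrite -subr_eq0 -mulrBl mulf_eq0 (negbTE (lam_neq j Kj)).
    by move/eqP.
  have S0 j : mode K j -> sin_coef delta phi j = 0.
    move=> Kj; have := tests j phi Kj phiL.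
    rewrite Lm; last exact: L2_itv_sin_mode.
    move/eqP; rewrite -subr_eq0 -mulrBl mulf_eq0 (negbTE (lam_neq j Kj)).
    by move/eqP.
  (* Testing on phi itself: m <phi, phi> = <Lop phi, phi>, and every summand of the form vanishes,
     whatever n. *)
  apply: phi0; apply: inner_itv_eq0 => //; apply: (mulfI m0).
  rewrite mulr0 -Lm//; apply: (form _ _ 0%N) => // n nK.
  rewrite /covariance_form big_nat_cond big1// => k /andP[/andP[k0 kn] _].
  have Kk : mode K k.
    by move: nK; rewrite /mode k0; case: (K) => // k' /eqP <-.
  by rewrite C0// S0// !mul0r addr0 mulr0.
move=> [j Kj ->].
have j0 : (0 < j)%N by case/andP: Kj.
set l := lambda _ _ _ _ _.
have cL := L2_itv_cos_mode delta j.
exists (cos_mode delta j); split => //.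
  (* If the cosine vanished almost everywhere, its own coefficient delta / 2 would be 0. *)
  move=> c0.
  have [+ _ _ _] := coef_modes delta delta_gt0 j j j0 j0.
  rewrite /cos_coef -/(cos_mode delta j).
  rewrite (@eq_inner_itv _ _ _ _ (cst 0))//; last first.
    by apply: (@L2_itv_bounded _ _ _ _ 0) => // x; rewrite normr0.
  rewrite /inner_itv; under eq_Rintegral do rewrite mul0r.
  rewrite Rintegral_cst ?mul0r; last exact: measurable_itv.
  move/esym/eqP; rewrite eqxx mulr1 mulf_eq0 invr_eq0 pnatr_eq0.
  by rewrite (gt_eqF delta_gt0).
have [LcL _] := Lop_def _ cL.
(* The residual of the eigenvalue equation is square-integrable, hence an admissible test function;
   testing it on itself gives <r, r> = 0. *)
set r := fun s => Lop (cos_mode delta j) s - l * cos_mode delta j s.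
have rL : L2_itv 0 delta r by exact: L2_itv_subZ.
suff : ae_eq lebesgue_measure `[0, delta]%classic r (cst 0).
  by apply: filterS => x /[apply] /eqP; rewrite /r subr_eq0 => /eqP.
apply: inner_itv_eq0 => //.
have -> : inner_itv 0 delta r r = inner_itv 0 delta (Lop (cos_mode delta j)) r -
    l * inner_itv 0 delta (cos_mode delta j) r.
  rewrite -innerZ// /inner_itv -RintegralB//.
  - by apply: eq_Rintegral => x _; rewrite -mulrBl.
  - exact: L2_itv_integrable_mul.
  - by apply: L2_itv_integrable_mul => //; exact: Lfun2Z.
apply/eqP; rewrite subr_eq0; apply/eqP.
apply: (form _ _ j) => // n /(modeP _ _ Kj) jn.
(* Symmetry moves the mode to the second argument, where [covariance_form_mode] evaluates the
   form. *)
rewrite covariance_formC.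
have [-> _] := covariance_form_mode delta delta_gt0 L alpha bhat n j r jn.
congr (_ * _); rewrite /cos_coef /inner_itv.
by apply: eq_Rintegral => x _; rewrite mulrC.
Qed.
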